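(* Let $2<p<\infty$ and let $w=(w_n)$ be a sequence of positive reals with $w_n\to0$ and $\sum_{n}w_n^{2p/(p-2)}=\infty$. Then the unit vector basis $(e_n)$ of $X_{p,w}$ has the factorization property: whenever $T\colon X_{p,w}\to X_{p,w}$ is a bounded linear operator with $\inf_n|e_n^*(Te_n)|>0$, there exist bounded linear operators $A,B\colon X_{p,w}\to X_{p,w}$ with $ATB=I$, the identity on $X_{p,w}$.
   Context: $X_{p,w}$ is the space of real sequences $(x_n)$ with $(x_n)\in\ell_p$ and $(x_nw_n)\in\ell_2$, normed by $\|(x_n)\|=\max\{\|(x_n)\|_{\ell_p},\|(x_nw_n)\|_{\ell_2}\}$; the unit vectors $(e_n)$ form an unconditional shrinking basis, and $(e_n^* )$ are the coordinate functionals. *)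

(* Defs.v *)
From HB Require Import structures.
From mathcomp Require Import all_boot all_order all_algebra.
From mathcomp Require Import all_classical all_reals all_analysis.
Set Implicit Arguments. Unset Strict Implicit. Unset Printing Implicit Defensive.
Import Order.TTheory GRing.Theory Num.Theory.
Import numFieldNormedType.Exports.
Local Open Scope ring_scope.

Section Xpw.
Variable R : realType.

Definition lp_sum (p : R) (x : nat -> R) : \bar R :=
  (\sum_(0 <= k <oo) ((`|x k| `^ p)%:E))%E.

Definition wl2_sum (w x : nat -> R) : \bar R :=
  (\sum_(0 <= k <oo) (((x k * w k) ^+ 2)%:E))%E.

Definition inX (p : R) (w : nat -> R) (x : nat -> R) : Prop :=
  (lp_sum p x < +oo)%E /\ (wl2_sum w x < +oo)%E.

Definition Xnorm (p : R) (w : nat -> R) (x : nat -> R) : R :=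
  Num.max ((fine (lp_sum p x)) `^ (p^-1)) (Num.sqrt (fine (wl2_sum w x))).

(* bounded linear operator X_{p,w} -> X_{p,w}, represented by a map on
   sequences whose behaviour outside X_{p,w} is irrelevant *)
Definition bounded_op (p : R) (w : nat -> R)
    (T : (nat -> R) -> (nat -> R)) : Prop :=
  [/\ (forall x, inX p w x -> inX p w (T x)),
      (forall (a : R) x y, inX p w x -> inX p w y ->
          T (fun n => a * x n + y n) = (fun n => a * T x n + T y n)) &
      exists C : R, forall x, inX p w x -> Xnorm p w (T x) <= C * Xnorm p w x].

(* unit vector e_n; e_n^*(y) = y n *)
Definition unitv (n : nat) : nat -> R := fun k => if k == n then 1 else 0.

End Xpw.

(* Main.v *)
(** Put [q = 2p/(p-2)].  Since [w n -> 0] and [sum w^q] diverges, arbitrarily far out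
    there are finite intervals on which [w^q] sums to about [w k ^ q].  A vector on
    such an interval with coefficients proportional to [w^(q/p)], normalised in [l_p],
    has weighted [l_2] norm about [w k], so successive such blocks are equivalent to
    the unit vector basis and are complemented by the dual coefficients.  A choice of
    signs makes the diagonal entry of [T] on each block at least [delta]; far-out
    blocks interact weakly because [T] of a fixed block has small tails and every
    bounded functional is small on tails (the basis is shrinking).  After dividing by
    the diagonal, [T] compressed to the blocks is within [1/2] of the identity and
    a Neumann series inverts it. *)

Require Import Defs.
From HB Require Import structures.
From mathcomp Require Import all_boot all_order all_algebra.
From mathcomp Require Import all_classical all_reals all_analysis.
From mathcomp Require Import ring lra.
Set Implicit Arguments. Unset Strict Implicit. Unset Printing Implicit Defensive.
Import Order.TTheory GRing.Theory Num.Theory.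
Import numFieldNormedType.Exports.
Local Open Scope classical_set_scope.
Local Open Scope ring_scope.

(** * Finite sums of powers: convexity, Minkowski's inequality, tails *)

Section FiniteSums.
Context {R : realType}.
Implicit Types (x y u : nat -> R).

Lemma nneseries_le u (M : R) : (forall k, 0 <= u k) ->
  (forall n, \sum_(0 <= k < n) u k <= M) ->
  (\sum_(0 <= k <oo) (u k)%:E <= M%:E)%E.
Proof.
move=> u0 uM; apply: lime_le.
  by apply: is_cvg_nneseries => n _ _; rewrite lee_fin.
by apply: nearW => n; rewrite sumEFin lee_fin.
Qed.

Lemma sum_le_nneseries u n : (forall k, 0 <= u k) ->
  (\sum_(0 <= k <oo) (u k)%:E < +oo)%E ->
  \sum_(0 <= k < n) u k <= fine (\sum_(0 <= k <oo) (u k)%:E)%E.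
Proof.
move=> u0 uoo; rewrite -lee_fin fineK; last first.
  by rewrite ge0_fin_numE//; apply: nneseries_ge0 => k _ _; rewrite lee_fin.
by rewrite -sumEFin; apply: nneseries_lim_ge => k _ _; rewrite lee_fin.
Qed.

Lemma powR_convex (r s t a b : R) : 1 <= r -> 0 <= s -> 0 <= t -> s + t = 1 ->
  0 <= a -> 0 <= b -> (s * a + t * b) `^ r <= s * a `^ r + t * b `^ r.
Proof.
move=> r1 s0 t0 st a0 b0.
have s1 : s <= 1 by lra.
have s01 : Itv.spec (@Itv.num_sem R) (Itv.Real `[0%Z, 1%Z]) s.
  by rewrite /Itv.spec /= /Itv.num_sem /= num_real /= in_itv /= s0 s1.
have aI : a \in (`[0, +oo[%classic : set R) by rewrite inE /= in_itv /= a0.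
have bI : b \in (`[0, +oo[%classic : set R) by rewrite inE /= in_itv /= b0.
have := @convex_powR R r r1 (Itv.mk s01) a b aI bI.
move=> H; rewrite convRE [X in X `^ _ <= _]convRE /= in H; move: H.
by have -> : unstable.onem s = t by rewrite /unstable.onem; lra.
Qed.

Lemma powR_le (r a b : R) : 0 <= r -> 0 <= a -> a <= b -> a `^ r <= b `^ r.
Proof.
move=> r0 a0 ab; apply: ge0_ler_powR => //; rewrite nnegrE //.
exact: le_trans ab.
Qed.

Lemma powRK (r a : R) : r != 0 -> 0 <= a -> (a `^ r) `^ r^-1 = a.
Proof. by move=> r0 a0; rewrite -powRrM mulfV // powRr1. Qed.

Lemma powRVK (r a : R) : r != 0 -> 0 <= a -> (a `^ r^-1) `^ r = a.
Proof. by move=> r0 a0; rewrite -powRrM mulVf // powRr1. Qed.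

Lemma powR_divr (r a c : R) : 0 <= a -> 0 < c -> a `^ r / c `^ r = (a / c) `^ r.
Proof.
move=> a0 c0; have ac0 : 0 <= a / c by rewrite divr_ge0 // ltW.
have /(congr1 (fun z => z / c `^ r)) := powRM r ac0 (ltW c0).
by rewrite divfK ?gt_eqF// mulfK// gt_eqF// powR_gt0.
Qed.

Lemma norm_powR2 (a : R) : `|a| `^ 2 = a ^+ 2.
Proof. by rewrite (powR_mulrn 2) // real_normK // num_real. Qed.

(** Taking [r]-th roots turns the hypothesis into a bound by [c + e] for every [e > 0]. Estimates
    may thus be proved for strictly positive bounds, by which one can divide. *)
Lemma powR_sum_closed (r : R) x n (c : R) : 1 <= r -> 0 <= c ->
  (forall e, 0 < e -> \sum_(0 <= k < n) `|x k| `^ r <= (c + e) `^ r) ->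
  \sum_(0 <= k < n) `|x k| `^ r <= c `^ r.
Proof.
move=> r1 c0 H; set S := \sum_(_ <= _ < _) _ in H *.
have r0 : r != 0 by apply/eqP; lra.
have S0 : 0 <= S by apply: sumr_ge0 => k _; exact: powR_ge0.
rewrite -(powRVK r0 S0); apply: powR_le; [lra | exact: powR_ge0 |].
apply/ler_addgt0Pr => e e0; rewrite -[leRHS](powRK r0); last lra.
by apply: powR_le; rewrite ?invr_ge0 ?H//; lra.
Qed.

(** Convexity of the [r]-th power is applied to [|x k| / c] and [|y k| / d] with weights
    [c / (c + d)] and [d / (c + d)], then summed. Bounds in place of norms avoid roots of sums. *)
Lemma finite_minkowski (r : R) x y n (c d : R) : 1 <= r -> 0 < c -> 0 < d ->
  \sum_(0 <= k < n) `|x k| `^ r <= c `^ r ->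
  \sum_(0 <= k < n) `|y k| `^ r <= d `^ r ->
  \sum_(0 <= k < n) `|x k + y k| `^ r <= (c + d) `^ r.
Proof.
move=> r1 c0 d0 hx hy.
have cd0 : 0 < c + d by lra.
have cr : 0 < c `^ r by exact: powR_gt0.
have dr : 0 < d `^ r by exact: powR_gt0.
have H k : `|x k + y k| `^ r <= (c + d) `^ r *
    (c / (c + d) * (`|x k| `^ r / c `^ r) + d / (c + d) * (`|y k| `^ r / d `^ r)).
  have xc : 0 <= `|x k| / c by rewrite divr_ge0 // ltW.
  have yd : 0 <= `|y k| / d by rewrite divr_ge0 // ltW.
  rewrite !powR_divr //.
  apply: (@le_trans _ _ ((c + d) `^ r *
      (c / (c + d) * (`|x k| / c) + d / (c + d) * (`|y k| / d)) `^ r)).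
    rewrite -powRM ?(ltW cd0)//; last first.
      by rewrite addr_ge0// mulr_ge0// divr_ge0// ltW.
    apply: powR_le; [lra | by [] |].
    apply: (le_trans (ler_normD _ _)); rewrite le_eqVlt; apply/orP; left.
    by apply/eqP; field; rewrite !gt_eqF.
  rewrite ler_wpM2l ?powR_ge0//; apply: powR_convex => //.
  - by rewrite divr_ge0 // ltW.
  - by rewrite divr_ge0 // ltW.
  - by field; rewrite gt_eqF.
apply: (le_trans (ler_sum _ (fun k _ => H k))).
rewrite -mulr_sumr -[leRHS]mulr1 ler_wpM2l ?powR_ge0//.
rewrite big_split /= -!mulr_sumr -!mulr_suml.
have -> : 1 = c / (c + d) * 1 + d / (c + d) * 1 by field; rewrite gt_eqF.
by apply: lerD; rewrite ler_wpM2l ?divr_ge0 ?(ltW cd0) ?(ltW c0) ?(ltW d0)//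
  ler_pdivrMr // mul1r.
Qed.

Lemma sum_tail_le u (C e : R) : (forall k, 0 <= u k) ->
  (forall n, \sum_(0 <= k < n) u k <= C) -> 0 < e ->
  exists N, forall n, \sum_(0 <= k < n) (if (N <= k)%N then u k else 0) <= e.
Proof.
move=> u0 uC e0; pose s n := \sum_(0 <= k < n) u k.
have hs : has_sup (range s).
  by split; [exists (s 0%N); exists 0%N | exists C => _ [n _ <-]; exact: uC].
(* At [N] the partial sum is within [e] of the supremum, so the later terms add up to less than
   [e]. *)
have [_ [N _ <-] sN] := sup_adherent e0 hs.
exists N => n.
have [nN|Nn] := leqP n N.
  rewrite big_nat big1 ?ltW // => k /andP[_ kn]; rewrite leqNgt ifF//.
  by rewrite (leq_trans kn nN).
have sn : s n <= sup (range s) by apply: ub_le_sup; [case: hs | exists n].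
have -> : \sum_(0 <= k < n) (if (N <= k)%N then u k else 0) = s n - s N.
  rewrite /s (big_cat_nat (n := N)) //=; last exact: ltnW.
  rewrite [X in _ = X - _](big_cat_nat (n := N)) //=; last exact: ltnW.
  rewrite [X in X + _ = _]big_nat big1 ?add0r; last first.
    by move=> k /andP[_ kN]; rewrite leqNgt kN.
  rewrite addrAC subrr add0r big_nat [RHS]big_nat.
  by apply: eq_bigr => k /andP[Nk _]; rewrite Nk.
lra.
Qed.

End FiniteSums.

(** * The norm of the space through bounds on finite sums *)

Section Norm.
Variables (R : realType) (p : R) (w : nat -> R).
Hypothesis hp : 2 < p.
Implicit Types (x y : nat -> R) (c d : R).

Let p_ge0 : 0 <= p. Proof. by move: hp => h; lra. Qed.
Let p_ge1 : 1 <= p. Proof. by move: hp => h; lra. Qed.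
Let p0 : p != 0. Proof. by rewrite gt_eqF//; move: hp => h; lra. Qed.
Let pV_ge0 : 0 <= p^-1. Proof. by rewrite invr_ge0. Qed.

(* [Xnorm p w x <= c] together with [inX p w x], in terms of finite sums only. *)
Definition norm_le x c := 0 <= c /\ forall n,
  \sum_(0 <= k < n) `|x k| `^ p <= c `^ p /\
  \sum_(0 <= k < n) (x k * w k) ^+ 2 <= c ^+ 2.

Lemma norm_le_Xnorm x : inX p w x -> norm_le x (Xnorm p w x).
Proof.
case=> hl hw; rewrite /Xnorm.
have l0 : 0 <= fine (lp_sum p x).
  by apply/fine_ge0/nneseries_ge0 => k _ _; rewrite lee_fin powR_ge0.
have w0 : 0 <= fine (wl2_sum w x).
  by apply/fine_ge0/nneseries_ge0 => k _ _; rewrite lee_fin sqr_ge0.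
split=> [|n]; first by rewrite le_max powR_ge0.
split.
  apply: (@le_trans _ _ (fine (lp_sum p x))).
    by apply: sum_le_nneseries => // k; rewrite powR_ge0.
  rewrite -[leLHS](powRVK p0 l0); apply: powR_le; rewrite ?powR_ge0//.
  by rewrite le_max lexx.
apply: (@le_trans _ _ (fine (wl2_sum w x))).
  by apply: sum_le_nneseries => // k; rewrite sqr_ge0.
rewrite -[leLHS](sqr_sqrtr w0) ler_sqr ?nnegrE ?sqrtr_ge0 ?le_max ?powR_ge0//.
by rewrite lexx orbT.
Qed.

Lemma norm_le_inX x c : norm_le x c -> inX p w x.
Proof.
case=> c0 hn; split; apply: le_lt_trans.
- by apply: (@nneseries_le _ _ (c `^ p)) => [k|n]; [exact: powR_ge0 | case: (hn n)].
- exact: ltry.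
- by apply: (@nneseries_le _ _ (c ^+ 2)) => [k|n]; [exact: sqr_ge0 | case: (hn n)].
- exact: ltry.
Qed.

Lemma Xnorm_le x c : norm_le x c -> Xnorm p w x <= c.
Proof.
move=> hx; have [hl hw] := norm_le_inX hx; case: hx => c0 hn.
rewrite /Xnorm ge_max; apply/andP; split.
  rewrite -[leRHS](powRK p0 c0); apply: powR_le => //.
    by apply/fine_ge0/nneseries_ge0 => k _ _; rewrite lee_fin powR_ge0.
  rewrite -lee_fin fineK; last first.
    by rewrite ge0_fin_numE//; apply: nneseries_ge0 => k _ _; rewrite lee_fin powR_ge0.
  by apply: nneseries_le => [k|n]; [exact: powR_ge0 | case: (hn n)].
rewrite -[leRHS](ger0_norm c0) -sqrtr_sqr ler_wsqrtr// -lee_fin fineK; last first.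
  by rewrite ge0_fin_numE//; apply: nneseries_ge0 => k _ _; rewrite lee_fin sqr_ge0.
by apply: nneseries_le => [k|n]; [exact: sqr_ge0 | case: (hn n)].
Qed.

Lemma norm_leW x c d : c <= d -> norm_le x c -> norm_le x d.
Proof.
move=> cd [c0 hn]; have d0 : 0 <= d by lra.
split=> // n; have [h1 h2] := hn n; split.
  by apply: (le_trans h1); apply: powR_le.
by apply: (le_trans h2); rewrite ler_sqr.
Qed.

Lemma norm_le_closed x c : 0 <= c ->
  (forall e, 0 < e -> norm_le x (c + e)) -> norm_le x c.
Proof.
move=> c0 H; split=> // n; split.
  apply: powR_sum_closed => //.
  by move=> e /H [_ /(_ n)[]].
have : \sum_(0 <= k < n) `|x k * w k| `^ 2 <= c `^ 2.
  apply: powR_sum_closed => //; first by lra.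
  move=> e e0; have [_ /(_ n)[_]] := H e e0.
  rewrite (powR_mulrn 2) ?addr_ge0 ?(ltW e0)//.
  by under [X in _ -> X <= _]eq_bigr do rewrite norm_powR2.
by rewrite (powR_mulrn 2)//; under eq_bigr do rewrite norm_powR2.
Qed.

Lemma norm_leD x y c d : norm_le x c -> norm_le y d ->
  norm_le (fun n => x n + y n) (c + d).
Proof.
move=> hx hy; have [c0 _] := hx; have [d0 _] := hy.
apply: norm_le_closed => [|e e0]; first exact: addr_ge0.
(* Padding by [e / 2] makes both bounds strictly positive, as [finite_minkowski] requires;
   [norm_le_closed] removes the padding. *)
have {hx}[_ hx] : norm_le x (c + e / 2) by apply: norm_leW hx; lra.
have {hy}[_ hy] : norm_le y (d + e / 2) by apply: norm_leW hy; lra.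
have -> : c + d + e = (c + e / 2) + (d + e / 2) by field.
have c1 : 0 < c + e / 2 by lra.
have d1 : 0 < d + e / 2 by lra.
split=> [|n]; first by lra.
have [hx1 hx2] := hx n; have [hy1 hy2] := hy n.
split; first by apply: finite_minkowski.
have Q (z : nat -> R) : \sum_(0 <= k < n) z k ^+ 2 = \sum_(0 <= k < n) `|z k| `^ 2.
  by apply: eq_bigr => k _; rewrite norm_powR2.
have hx3 : \sum_(0 <= k < n) `|x k * w k| `^ 2 <= (c + e / 2) `^ 2.
  by rewrite -Q (powR_mulrn 2) ?(ltW c1).
have hy3 : \sum_(0 <= k < n) `|y k * w k| `^ 2 <= (d + e / 2) `^ 2.
  by rewrite -Q (powR_mulrn 2) ?(ltW d1).
rewrite Q -(powR_mulrn 2); last exact: addr_ge0 (ltW c1) (ltW d1).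
under eq_bigr do rewrite mulrDl.
by apply: finite_minkowski => //; lra.
Qed.

Lemma norm_leZ x a c : norm_le x c -> norm_le (fun n => a * x n) (`|a| * c).
Proof.
case=> c0 hn; split=> [|n]; first exact: mulr_ge0.
have [h1 h2] := hn n; split.
  rewrite powRM//; under eq_bigr do rewrite normrM powRM//.
  by rewrite -mulr_sumr ler_wpM2l ?powR_ge0.
under eq_bigr do rewrite -mulrA exprMn.
by rewrite -mulr_sumr exprMn real_normK ?num_real// ler_wpM2l ?sqr_ge0.
Qed.

Lemma norm_le_abs x y c : (forall n, `|y n| <= `|x n|) -> norm_le x c -> norm_le y c.
Proof.
move=> xy [c0 hn]; split=> // n; have [h1 h2] := hn n; split.
  apply: le_trans h1; apply: ler_sum => k _.
  by apply: powR_le.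
apply: le_trans h2; apply: ler_sum => k _.
by rewrite -[leLHS]real_normK ?num_real// -[leRHS]real_normK ?num_real//
  ler_sqr ?nnegrE// !normrM ler_wpM2r.
Qed.

Lemma norm_le0 : norm_le (fun=> 0) 0.
Proof.
split=> // n; split; rewrite big1 ?powR_ge0 ?sqr_ge0// => k _.
  by rewrite normr0 powR0.
by rewrite mul0r expr0n.
Qed.

Lemma norm_le_coord x c n : norm_le x c -> `|x n| <= c.
Proof.
case=> c0 /(_ n.+1)[h _]; rewrite -[leLHS](powRK p0 (normr_ge0 (x n))) -[leRHS](powRK p0 c0).
apply: powR_le; rewrite ?powR_ge0//.
apply: le_trans h; rewrite big_nat_recr //= lerDr.
by apply: sumr_ge0 => k _; exact: powR_ge0.
Qed.

Lemma norm_le_tail x c e : norm_le x c -> 0 < e ->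
  exists N, norm_le (fun n => if (N <= n)%N then x n else 0) e.
Proof.
move=> [c0 hn] e0.
have ep : 0 < e `^ p by exact: powR_gt0.
have e2 : 0 < e ^+ 2 by exact: exprn_gt0.
have [N1 h1] := @sum_tail_le R (fun k => `|x k| `^ p) _ _ (fun k => powR_ge0 _ _)
  (fun n => (hn n).1) ep.
have [N2 h2] := @sum_tail_le R (fun k => (x k * w k) ^+ 2) _ _ (fun k => sqr_ge0 _)
  (fun n => (hn n).2) e2.
exists (maxn N1 N2); split=> [|n]; first exact: ltW.
split.
  apply: le_trans (h1 n); apply: ler_sum => k _ /=; rewrite geq_max.
  case: (leqP N1 k) => _ /=; case: (leqP N2 k) => _; rewrite ?normr0 ?powR0//.
apply: le_trans (h2 n); apply: ler_sum => k _ /=; rewrite geq_max.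
case: (leqP N1 k) => _ /=; case: (leqP N2 k) => _; rewrite ?mul0r ?expr0n ?sqr_ge0//=.
Qed.

Lemma norm_le_unitv k c : `|w k| <= c -> 1 <= c -> norm_le (unitv R k) c.
Proof.
move=> wc c1; have c0 : 0 <= c by lra.
have E (f : R -> R) (n : nat) : f 0 = 0 ->
    \sum_(0 <= i < n) f (unitv R k i) = if (k < n)%N then f 1 else 0.
  move=> f0; elim: n => [|n IH]; first by rewrite big_geq.
  rewrite big_nat_recr //= IH /unitv.
  by case: (ltngtP k n) => [kn|kn|->]; rewrite ?f0 ?addr0 ?add0r ?ltnS
    ?(ltnW kn) ?leqnn// leqNgt kn.
split=> // n; split.
  rewrite (E (fun t => `|t| `^ p)) ?normr0 ?powR0// normr1 powR1.
  case: ifP => _; rewrite ?powR_ge0//.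
  by have := powR_le (r := p) (a := 1) (b := c) _ ler01 c1; rewrite powR1; apply.
have -> : \sum_(0 <= i < n) (unitv R k i * w i) ^+ 2 =
          \sum_(0 <= i < n) (unitv R k i * w k) ^+ 2.
  by apply: eq_bigr => i _; rewrite /unitv; case: eqP => [->|]; rewrite ?mul0r.
rewrite (E (fun t => (t * w k) ^+ 2)) ?mul0r ?expr0n// mul1r.
case: ifP => _; rewrite ?sqr_ge0//.
by rewrite -real_normK ?num_real// ler_sqr.
Qed.

Lemma norm_le_prefix x c : 0 <= c ->
  (forall N, norm_le (fun n => if (n < N)%N then x n else 0) c) -> norm_le x c.
Proof.
move=> c0 H; split=> // n; have [_ /(_ n) [h1 h2]] := H n; split.
  by apply: le_trans h1; rewrite big_nat [leRHS]big_nat; apply: ler_sum => k /andP[_ ->].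
by apply: le_trans h2; rewrite big_nat [leRHS]big_nat; apply: ler_sum => k /andP[_ ->].
Qed.

(** Triangle inequality over coordinates, each unit vector having norm at most [W]. Crude, but it
    turns coordinatewise estimates into norm estimates. *)
Lemma norm_le_prefix_sum x W N : 1 <= W -> (forall n, `|w n| <= W) ->
  norm_le (fun n => if (n < N)%N then x n else 0) (\sum_(0 <= k < N) (`|x k| * W)).
Proof.
move=> W1 wW; elim: N => [|N IH]; first by rewrite big_geq //; exact: norm_le0.
rewrite big_nat_recr //=.
have h := norm_leZ (x N) (norm_le_unitv (wW N) W1).
apply: norm_le_abs (norm_leD IH h) => n; rewrite /unitv ltnS.
by case: (ltngtP n N) => [|_|->]; rewrite ?mulr0 ?mulr1 ?addr0 ?add0r ?normr0.
Qed.

End Norm.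

(** * Cauchy-Schwarz, Hölder, and the choices of signs, intervals and sequences *)

Section Inequalities.
Context {R : realType}.
Implicit Types (u y a b : nat -> R).

Lemma cauchy_schwarz_sum a b m M : 0 < \sum_(m <= n < M) a n ^+ 2 ->
  (\sum_(m <= n < M) a n * b n) ^+ 2 <=
  (\sum_(m <= n < M) a n ^+ 2) * \sum_(m <= n < M) b n ^+ 2.
Proof.
set A := \sum_(_ <= _ < _) a _ ^+ 2; set s := \sum_(_ <= _ < _) _ * _.
set B := \sum_(_ <= _ < _) b _ ^+ 2; move=> A0.
have : 0 <= \sum_(m <= n < M) (s / A * a n - b n) ^+ 2.
  by apply: sumr_ge0 => n _; exact: sqr_ge0.
have -> : \sum_(m <= n < M) (s / A * a n - b n) ^+ 2 =
    (s / A) ^+ 2 * A - 2 * (s / A) * s + B.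
  rewrite /A /s /B !mulr_sumr -sumrB -big_split /=.
  by apply: eq_bigr => n _; ring.
have -> : (s / A) ^+ 2 * A - 2 * (s / A) * s + B = (A * B - s ^+ 2) / A.
  by field; rewrite gt_eqF.
by rewrite pmulr_lge0 ?invr_gt0// subr_ge0.
Qed.

(** The weights [u n ^ (1 - 1/p)] have conjugate norm one. With [A] the sum on the left, Young's
    inequality for [|y n|] and [u n ^ (1 - 1/p) * A ^ (p - 1)] adds up to [p * A ^ p <= sum |y n| ^
    p + (p - 1) * A ^ p], with no division by [A]. *)
Lemma hoelder_unit_sum (p : R) u y m M : 1 < p ->
  (forall n, 0 <= u n) -> \sum_(m <= n < M) u n = 1 ->
  (\sum_(m <= n < M) u n `^ (1 - p^-1) * `|y n|) `^ p <=
  \sum_(m <= n < M) `|y n| `^ p.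
Proof.
move=> p1 u0 usum; set A := \sum_(_ <= _ < _) _ * _.
have A0 : 0 <= A by apply: sumr_ge0 => n _; rewrite mulr_ge0// powR_ge0.
have p0 : 0 < p by lra.
have q0 : 0 < p / (p - 1) by rewrite divr_gt0//; lra.
have pq : p^-1 + (p / (p - 1))^-1 = 1 by field; apply/andP; split; apply/eqP; lra.
have H n : p * (A `^ (p - 1) * (u n `^ (1 - p^-1) * `|y n|)) <=
    `|y n| `^ p + (p - 1) * (A `^ p * u n).
  have := conjugate_powR (normr_ge0 (y n))
    (mulr_ge0 (powR_ge0 (u n) (1 - p^-1)) (powR_ge0 A (p - 1))) p0 q0 pq.
  rewrite powRM ?powR_ge0// -!powRrM.
  have -> : (1 - p^-1) * (p / (p - 1)) = 1 by field; apply/andP; split; apply/eqP; lra.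
  have -> : (p - 1) * (p / (p - 1)) = p by field; apply/eqP; lra.
  rewrite powRr1// => /(ler_wpM2l (ltW p0)); congr (_ <= _); first by ring.
  by field; apply/andP; split; apply/eqP; lra.
have : p * A `^ p <= \sum_(m <= n < M) `|y n| `^ p + (p - 1) * A `^ p.
  rewrite -{1}(mulr_powRB1 A0 p0) [A * _]mulrC {2}/A mulr_sumr mulr_sumr.
  apply: (le_trans (ler_sum _ (fun n _ => H n))).
  by rewrite big_split /= -!mulr_sumr usum mulr1.
lra.
Qed.

(** Averaged over all signs the off-diagonal terms cancel, so some choice does at least as well as
    the diagonal. The induction finds one directly: [X] collects the terms coupling the new index to
    the old ones, and the new sign [s] makes [s * X] nonnegative. *)
Lemma sign_choice (a : nat -> nat -> R) m M : exists e : nat -> R,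
  (forall n, e n ^+ 2 = 1) /\ \sum_(m <= n < M) a n n <=
    \sum_(m <= n < M) \sum_(m <= k < M) e n * e k * a n k.
Proof.
elim: M => [|M [e [e1 IH]]].
  by exists (fun=> 1); split=> [n|]; rewrite ?expr1n// !big_geq.
have [mM|Mm] := leqP m M; last first.
  by exists (fun=> 1); split=> [n|]; rewrite ?expr1n// !big_geq.
pose X := \sum_(m <= n < M) (e n * a n M + e n * a M n).
pose s : R := if 0 <= X then 1 else -1.
have s1 : s * s = 1 by rewrite /s; case: ifP; rewrite ?mulr1// mulrN1 opprK.
have sX : 0 <= s * X.
  rewrite /s; case: ifP => [|/negbT]; rewrite ?mul1r// -ltNge mulN1r => h.
  by rewrite oppr_ge0 ltW.
pose e' n := if (n < M)%N then e n else s.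
exists e'; split=> [n|].
  by rewrite /e'; case: ifP => _; rewrite ?e1// expr2.
have e'M : e' M = s by rewrite /e' ltnn.
have e'E n : (n < M)%N -> e' n = e n by rewrite /e' => ->.
rewrite big_nat_recr //= [leRHS]big_nat_recr //= [X in _ <= _ + X]big_nat_recr //=.
under [X in _ <= X + _]eq_bigr do rewrite big_nat_recr //=.
rewrite big_split /= e'M s1 mul1r.
have -> : \sum_(m <= n < M) \sum_(m <= k < M) e' n * e' k * a n k =
    \sum_(m <= n < M) \sum_(m <= k < M) e n * e k * a n k.
  rewrite big_nat [RHS]big_nat; apply: eq_bigr => n /andP[_ nM].
  rewrite big_nat [RHS]big_nat; apply: eq_bigr => k /andP[_ kM].
  by rewrite !e'E.
have -> : \sum_(m <= n < M) e' n * s * a n M = \sum_(m <= n < M) s * (e n * a n M).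
  rewrite big_nat [RHS]big_nat; apply: eq_bigr => n /andP[_ nM].
  by rewrite e'E//; ring.
have -> : \sum_(m <= n < M) s * e' n * a M n = \sum_(m <= n < M) s * (e n * a M n).
  rewrite big_nat [RHS]big_nat; apply: eq_bigr => n /andP[_ nM].
  by rewrite e'E//; ring.
move: sX; rewrite /X big_split /= mulrDr !mulr_sumr => sX.
lra.
Qed.

(** Divergence gives some [M] whose sum reaches [t]. For the least one, the sum without its last
    term is below [t] and the last term is at most [t]. *)
Lemma interval_sum_choice u (t : R) N : (forall n, 0 <= u n) ->
  (\sum_(0 <= n <oo) (u n)%:E = +oo)%E -> 0 < t ->
  (forall n, (N <= n)%N -> u n <= t) ->
  exists M, (N < M)%N /\ t <= \sum_(N <= n < M) u n <= 2 * t.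
Proof.
move=> u0 uoo t0 ut.
have ex : exists M, t <= \sum_(N <= n < M) u n.
  apply: contrapT => H.
  suff : (\sum_(0 <= n <oo) (u n)%:E <= (\sum_(0 <= n < N) u n + t)%:E)%E.
    by rewrite uoo leye_eq.
  apply: nneseries_le => // n.
  have [nN|Nn] := leqP n N.
    rewrite (big_cat_nat (n := n) (p := N)) //= -addrA lerDl addr_ge0 ?(ltW t0)//.
    by apply: sumr_ge0.
  rewrite (big_cat_nat (n := N) (p := n)) //=; last exact: ltnW.
  rewrite lerD2l leNgt; apply/negP => h; apply: H; exists n; exact: ltW.
case: (ex_minnP ex) => M tM minM; exists M.
have NM : (N < M)%N.
  by rewrite ltnNge; apply/negP => MN; move: tM; rewrite big_geq// leNgt t0.
split=> //; rewrite tM /=; case: M tM minM NM => // M tM minM NM.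
rewrite big_nat_recr //=.
have h : \sum_(N <= n < M) u n < t.
  by rewrite ltNge; apply/negP => /minM; rewrite ltnn.
by have := ut M NM; lra.
Qed.

(** Dependent choice with the whole history available: a new block must be far from all earlier
    ones, not just from the last. *)
Lemma history_choice (S : Type) (P : seq S -> S -> Prop) :
  (forall l, exists s, P l s) -> exists f : nat -> S, forall n, P (mkseq f n) (f n).
Proof.
move=> /choice[F FP]; pose L n := iter n (fun l => rcons l (F l)) [::].
exists (fun n => F (L n)) => n.
suff -> : mkseq (fun n => F (L n)) n = L n by exact: FP.
by elim: n => // n IH; rewrite mkseqS IH.
Qed.

End Inequalities.

(** * Bounded operators and functionals on the space *)

Section Operators.
Variables (R : realType) (p : R) (w : nat -> R).
Hypothesis hp : 2 < p.
Implicit Types (x y : nat -> R) (c : R).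
Local Notation norm_le := (norm_le p w).
Local Notation inX := (inX p w).

Lemma inX_linear (a : R) x y : inX x -> inX y -> inX (fun n => a * x n + y n).
Proof.
move=> /(norm_le_Xnorm hp) hx /(norm_le_Xnorm hp) hy.
exact: norm_le_inX (norm_leD hp (norm_leZ a hx) hy).
Qed.

Lemma inX0 : inX (fun=> 0).
Proof. exact: norm_le_inX (norm_le0 w hp). Qed.

Lemma inX_add x y : inX x -> inX y -> inX (fun n => x n + y n).
Proof.
by move=> hx hy; have := inX_linear 1 hx hy; congr Defs.inX; apply/funext => n; rewrite mul1r.
Qed.

Lemma inX_unitv n : inX (unitv R n).
Proof.
apply: (@norm_le_inX _ _ _ _ (1 + `|w n|)).
by apply: norm_le_unitv; rewrite ?lerDl ?lerDr.
Qed.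

Lemma inX_sum (r : seq nat) (a : nat -> R) (z : nat -> nat -> R) :
  (forall i, inX (z i)) -> inX (fun n => \sum_(i <- r) a i * z i n).
Proof.
move=> hz; elim: r => [|i r IH].
  by under eq_fun do rewrite big_nil; exact: inX0.
by under eq_fun do rewrite big_cons; exact: inX_linear.
Qed.

Lemma bounded_op_norm_le T : bounded_op p w T ->
  exists2 C, 0 <= C & forall x c, norm_le x c -> norm_le (T x) (C * c).
Proof.
(* The constant in [bounded_op] carries no sign; a nonnegative one allows passing from [Xnorm p w x]
   to any larger bound [c]. *)
move=> [TX _ [C TC]]; exists (Num.max C 0) => [|x c hx].
  by rewrite le_max lexx orbT.
have hX := norm_le_inX hx.
apply: norm_leW (norm_le_Xnorm hp (TX _ hX)) => //.
have n0 : 0 <= Xnorm p w x by rewrite /Xnorm le_max powR_ge0.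
apply: (le_trans (TC _ hX)).
apply: (@le_trans _ _ (Num.max C 0 * Xnorm p w x)).
  by rewrite ler_wpM2r// le_max lexx.
by rewrite ler_wpM2l ?le_max ?lexx ?orbT//; exact: Xnorm_le.
Qed.

Lemma norm_le_bounded_op T C :
  (forall x c, norm_le x c -> norm_le (T x) (C * c)) ->
  (forall (a : R) x y, inX x -> inX y ->
    T (fun n => a * x n + y n) = (fun n => a * T x n + T y n)) ->
  bounded_op p w T.
Proof.
move=> TC Tlin; split=> // [x|].
  by move=> /(norm_le_Xnorm hp)/TC/norm_le_inX.
by exists C => x /(norm_le_Xnorm hp)/TC/(Xnorm_le hp).
Qed.

Section Linear.
Variable T : (nat -> R) -> (nat -> R).
Hypothesis Tlin : forall (a : R) x y, inX x -> inX y ->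
    T (fun n => a * x n + y n) = (fun n => a * T x n + T y n).

Lemma linear_op0 : T (fun=> 0) = fun=> 0.
Proof.
have := Tlin (-1) inX0 inX0.
have -> : (fun n : nat => -1 * 0 + 0) = (fun=> 0) :> (nat -> R).
  by apply/funext => n; rewrite mulr0 addr0.
by move=> ->; apply/funext => n; rewrite mulN1r addNr.
Qed.

Lemma linear_op_sum (r : seq nat) (a : nat -> R) (z : nat -> nat -> R) :
  (forall i, inX (z i)) ->
  T (fun n => \sum_(i <- r) a i * z i n) = fun n => \sum_(i <- r) a i * T (z i) n.
Proof.
move=> hz; elim: r => [|i r IH].
  under eq_fun do rewrite big_nil.
  by rewrite linear_op0; apply/funext => n; rewrite big_nil.
under eq_fun do rewrite big_cons.
rewrite Tlin//; last exact: inX_sum.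
by rewrite IH; apply/funext => n; rewrite big_cons.
Qed.

End Linear.

Section Functional.
Variables (f : (nat -> R) -> R) (C : R).
Hypothesis C0 : 0 <= C.
Hypothesis flin : forall (a : R) x y, inX x -> inX y ->
  f (fun n => a * x n + y n) = a * f x + f y.
Hypothesis fC : forall x c, norm_le x c -> `|f x| <= C * c.

Let f0 : f (fun=> 0) = 0.
Proof.
by have := fC (norm_le0 w hp); rewrite mulr0 normr_le0 => /eqP.
Qed.

Let fZ a x : inX x -> f (fun n => a * x n) = a * f x.
Proof.
move=> hx; have := flin a hx inX0; rewrite f0 addr0 => <-.
by congr f; apply/funext => n; rewrite addr0.
Qed.

Let fD x y : inX x -> inX y -> f (fun n => x n + y n) = f x + f y.
Proof.
move=> hx hy; have := flin 1 hx hy; rewrite mul1r => <-.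
by congr f; apply/funext => n; rewrite mul1r.
Qed.

(* [k ^ 2] disjointly supported unit vectors add up to a vector of norm at most [k],
   on which a functional staying above [eta / 2] on each of them would be at least
   [k ^ 2 * eta / 2]. *)
Lemma functional_tail_small eta : 0 < eta -> exists N, forall x c, norm_le x c ->
  (forall n, (n < N)%N -> x n = 0) -> `|f x| <= eta * c.
Proof.
move=> eta0; apply: contrapT => H.
(* If the claim fails at [N], the offending vector times [sg (f x) / c] has norm at most one and a
   value above [eta]. *)
have stepA N : exists x, [/\ norm_le x 1, forall n, (n < N)%N -> x n = 0 & eta < f x].
  apply: contrapT => K; apply: H; exists N => x c hx x0; rewrite leNgt.
  apply/negP => lt; apply: K; have [c0 _] := hx.
  have cgt0 : 0 < c.
    rewrite lt_def c0 andbT; apply/eqP => cE; move: lt.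
    by have := fC hx; rewrite cE !mulr0 => h1 h2; lra.
  exists (fun n => (Num.sg (f x) / c) * x n); split.
  - apply: norm_leW (norm_leZ (Num.sg (f x) / c) hx) => //.
    rewrite normrM normfV (gtr0_norm cgt0) divfK ?gt_eqF// normr_sg.
    by case: eqP.
  - by move=> n /x0 ->; rewrite mulr0.
  - rewrite fZ; last exact: norm_le_inX hx.
    by rewrite mulrAC -normrEsg ltr_pdivlMr.
have stepB N : exists M x, [/\ norm_le x 1, forall n, (n < N)%N -> x n = 0,
    forall n, (M <= n)%N -> x n = 0 & eta / 2 < f x].
  have [x [hx x0 fx]] := stepA N.
  (* Cutting off a tail of this size changes [f x] by at most [C * eta / (2 * (C + 1)) <= eta / 2];
     the [1] covers [C = 0]. *)
  have e0 : 0 < eta / (2 * (C + 1)) by move: C0 => ?; rewrite divr_gt0//; lra.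
  have [M ht] := norm_le_tail hp hx e0.
  exists M, (fun n => if (n < M)%N then x n else 0); have hh : norm_le
    (fun n => if (n < M)%N then x n else 0) 1.
    by apply: norm_le_abs hx => // n; case: ifP; rewrite ?normr0.
  split=> //.
  - by move=> n /x0 ->; case: ifP.
  - by move=> n; rewrite ltnNge => ->.
  have fxE : f x = f (fun n => if (n < M)%N then x n else 0) +
                   f (fun n => if (M <= n)%N then x n else 0).
    rewrite -fD; [|exact: norm_le_inX hh|exact: norm_le_inX ht].
    by congr f; apply/funext => n; case: leqP; rewrite ?addr0 ?add0r.
  have := fC ht; have -> : C * (eta / (2 * (C + 1))) = eta / 2 * (C / (C + 1)).
    by move: C0 => ?; field; apply/eqP; lra.
  have C1 : C / (C + 1) <= 1 by move: C0 => ?; rewrite ler_pdivrMr; lra.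
  have : eta / 2 * (C / (C + 1)) <= eta / 2 * 1 by rewrite ler_wpM2l//; lra.
  move=> h1 h2; have := ler_norm (f (fun n => if (M <= n)%N then x n else 0)).
  lra.
(* Here [m] vectors from [stepB] are placed one after another. Disjoint supports make both sums
   additive, so they grow at most linearly in [m], while [f y] grows at least linearly. *)
have stepC m : exists M y, [/\ inX y, forall n, (M <= n)%N -> y n = 0,
    forall n, \sum_(0 <= k < n) `|y k| `^ p <= m%:R /\
      \sum_(0 <= k < n) (y k * w k) ^+ 2 <= m%:R & m%:R * (eta / 2) <= f y].
  elim: m => [|m [M [y [Xy y0 ySum fy]]]].
    exists 0%N, (fun=> 0); split=> //; first exact: inX0; last by rewrite mul0r f0.
    have p0 : p != 0 by rewrite gt_eqF//; move: hp => ?; lra.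
    by have [_ h] := norm_le0 w hp; move=> n; have := h n; rewrite powR0 ?expr0n.
  have [M' [x [hx x0 x1 fx]]] := stepB M; have Xx := norm_le_inX hx.
  exists (maxn M M'), (fun n => y n + x n); split.
  - exact: inX_add.
  - by move=> n; rewrite geq_max => /andP[/y0 -> /x1 ->]; rewrite addr0.
  - move=> n; have [s1 s2] := ySum n; case: hx => _ /(_ n); rewrite powR1 expr1n => -[t1 t2].
    have p0 : p != 0 by rewrite gt_eqF//; move: hp => ?; lra.
    rewrite -natr1; split.
      have -> : \sum_(0 <= k < n) `|y k + x k| `^ p =
          \sum_(0 <= k < n) `|y k| `^ p + \sum_(0 <= k < n) `|x k| `^ p.
        rewrite -big_split /=; apply: eq_bigr => k _.
        by case: (leqP M k) => [/y0 ->|/x0 ->]; rewrite normr0 powR0// ?add0r ?addr0.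
      exact: lerD.
    have -> : \sum_(0 <= k < n) ((y k + x k) * w k) ^+ 2 =
        \sum_(0 <= k < n) (y k * w k) ^+ 2 + \sum_(0 <= k < n) (x k * w k) ^+ 2.
      rewrite -big_split /=; apply: eq_bigr => k _.
      by case: (leqP M k) => [/y0 ->|/x0 ->]; rewrite mul0r expr0n ?add0r ?addr0.
    exact: lerD.
  - by rewrite fD// -natr1 mulrDl mul1r lerD// ltW.
(* With [k ^ 2] vectors both sums are at most [k ^ 2 <= k ^ p], as [p > 2], so the norm is at most
   [k]. Then [k ^ 2 * eta / 2 <= k * C], against [k > 2 * C / eta]. *)
pose k := (Num.bound (2 * C / eta)).+1.
have [_ [y [_ _ ySum fy]]] := stepC (k ^ 2)%N.
have k1 : 1 <= k%:R :> R by rewrite ler1n.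
have hy : norm_le y k%:R.
  split=> // n; have [h1 h2] := ySum n; move: h1 h2; rewrite natrX => h1 h2; split=> //.
  apply: (le_trans h1); rewrite -(powR_mulrn 2)//; apply: ler_powR => //.
  by move: hp => ?; lra.
have : 2 * C / eta < k%:R.
  have h0 : 0 <= 2 * C / eta by rewrite divr_ge0 ?(ltW eta0)// mulr_ge0.
  by apply: (lt_trans (archi_boundP h0)); rewrite ltr_nat.
rewrite ltr_pdivrMr// => lt.
have : k%:R * (k%:R * (eta / 2)) <= k%:R * C.
  rewrite mulrA -expr2 -natrX (le_trans fy)// [leRHS]mulrC.
  by apply: le_trans (fC hy); exact: ler_norm.
rewrite ler_pM2l; last lra.
lra.
Qed.

End Functional.

End Operators.

(** * Construction of a single block *)

Section Blocks.
Variables (R : realType) (p : R) (w : nat -> R).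
Hypothesis hp : 2 < p.
Hypothesis hwpos : forall n, 0 < w n.
Local Notation inX := (inX p w).

Record block := Block { lo : nat; hi : nat; vec : nat -> R; dual : nat -> R }.

Definition pairing (s : block) (y : nat -> R) := \sum_(lo s <= n < hi s) dual s n * y n.

(** The pair [vec], [dual] imitates the [k]-th unit vector and its coordinate functional, in the
    [l_p] and the weighted [l_2] sense, up to the factor 4. The bounds involve only sums over the
    interval, so that those of disjoint blocks can be added. *)
Record block_for (T : (nat -> R) -> nat -> R) (delta : R) (k : nat) (s : block) : Prop := {
  lo_hi : (lo s < hi s)%N;
  vec_lo : forall n, (n < lo s)%N -> vec s n = 0;
  vec_hi : forall n, (hi s <= n)%N -> vec s n = 0;
  vec_lp : \sum_(lo s <= n < hi s) `|vec s n| `^ p <= 1;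
  vec_l2 : \sum_(lo s <= n < hi s) (vec s n * w n) ^+ 2 <= 4 * w k ^+ 2;
  pairing_lp : forall y, `|pairing s y| `^ p <= \sum_(lo s <= n < hi s) `|y n| `^ p;
  pairing_l2 : forall y,
    (pairing s y * w k) ^+ 2 <= \sum_(lo s <= n < hi s) (y n * w n) ^+ 2;
  pairing_diag : delta <= `|pairing s (T (vec s))| }.

Lemma sum_unitv (a : nat -> R) m M n : \sum_(m <= k < M) a k * unitv R k n =
  if (m <= n < M)%N then a n else 0.
Proof.
rewrite /unitv; case: ifP => [/andP[mn nM]|nmM].
  rewrite (bigD1_seq n) ?mem_index_iota ?mn ?nM ?iota_uniq//= eqxx mulr1.
  by rewrite big1 ?addr0// => k kn; rewrite eq_sym (negbTE kn) mulr0.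
rewrite big_nat big1// => k mkM; case: eqP => [nk|]; last by rewrite mulr0.
by rewrite nk mkM in nmM.
Qed.

(** This exponent satisfies [q / p + 1 = q / 2] and [q * (1 - 2 / p) = 2], on which the next two
    lemmas rest. *)
Let q := 2 * p / (p - 2).

Let p_gt0 : 0 < p. Proof. by move: hp => h; lra. Qed.
Let p0 : p != 0. Proof. by rewrite gt_eqF. Qed.
Let p2_gt0 : 0 < p - 2. Proof. by move: hp => h; lra. Qed.
Let q_gt0 : 0 < q. Proof. by rewrite divr_gt0// mulr_gt0. Qed.

(** Because [q / p + 1 = q / 2], both squares are constant multiples of [w n ^ q] and sum over the
    interval to multiples of [S]. The first measures [vec] in weighted [l_2], the second [dual] in
    its dual. *)
Lemma block_weight n (S : R) : 0 < S -> let v := w n `^ q / S in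
  (v `^ p^-1 * w n) ^+ 2 = w n `^ q * (S^-1 `^ p^-1) ^+ 2 /\
  (v `^ (1 - p^-1) / w n) ^+ 2 = w n `^ q / (S ^+ 2 * (S^-1 `^ p^-1) ^+ 2).
Proof.
move=> S0 v; have wn := hwpos n; have u0 : 0 < w n `^ q by exact: powR_gt0.
have v0 : 0 < v by rewrite divr_gt0.
have SV : 0 < S^-1 by rewrite invr_gt0.
have E1 : (v `^ p^-1 * w n) ^+ 2 = w n `^ q * (S^-1 `^ p^-1) ^+ 2.
  have -> : v `^ p^-1 = w n `^ (q / p) * S^-1 `^ p^-1.
    by rewrite /v powRM ?(ltW u0) ?(ltW SV)// -powRrM.
  have -> : w n `^ (q / p) * S^-1 `^ p^-1 * w n = w n `^ (q / 2) * S^-1 `^ p^-1.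
    rewrite mulrAC -{2}(powRr1 (ltW wn)) -powRD; last by rewrite (gt_eqF wn) implybT.
    have -> // : q / p + 1 = q / 2.
    by rewrite /q; field; rewrite p0 gt_eqF.
  rewrite exprMn -[in LHS](powR_mulrn 2 (powR_ge0 _ _)) -powRrM.
  by have -> : q / 2 * 2 = q by field.
split=> //.
have D0 : 0 < S^-1 `^ p^-1 by exact: powR_gt0.
have V0 : 0 < v `^ p^-1 by exact: powR_gt0.
have -> : v `^ (1 - p^-1) = v / v `^ p^-1.
  by rewrite powRB ?powRr1 ?(ltW v0)// (gt_eqF v0) implybT.
have -> : (v / v `^ p^-1 / w n) ^+ 2 = v ^+ 2 / (v `^ p^-1 * w n) ^+ 2.
  by field; rewrite !gt_eqF.
by rewrite E1 /v; field; rewrite !gt_eqF.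
Qed.

(** The middle term is [S ^ (1 - 2 / p)], and [w k ^ q] to this power is [w k ^ 2]. The loss
    [2 ^ (1 - 2 / p) <= 2] is rounded up to the square 4. *)
Lemma block_size k (S : R) : w k `^ q <= S <= 2 * w k `^ q ->
  w k ^+ 2 <= S * (S^-1 `^ p^-1) ^+ 2 <= 4 * w k ^+ 2.
Proof.
move=> /andP[S1 S2]; have wk := hwpos k.
have u0 : 0 < w k `^ q by exact: powR_gt0.
have S0 : 0 < S by lra.
have e0 : 0 <= 1 - 2 / p by rewrite subr_ge0 ler_pdivrMr// mul1r ltW.
have -> : S * (S^-1 `^ p^-1) ^+ 2 = S `^ (1 - 2 / p).
  rewrite powRB; last by rewrite (gt_eqF S0) implybT.
  rewrite powRr1 ?(ltW S0)//; congr (_ * _).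
  by rewrite -(powR_mulrn 2) ?powR_ge0// -powRrM -powR_inv1 ?(ltW S0)// -powRrM
    -powRN; congr (_ `^ _); field.
have uE : (w k `^ q) `^ (1 - 2 / p) = w k ^+ 2.
  rewrite -powRrM (_ : q * _ = 2) ?(powR_mulrn 2) ?(ltW wk)//.
  by rewrite /q; field; rewrite p0 gt_eqF.
apply/andP; split; first by rewrite -uE powR_le// ltW.
apply: (@le_trans _ _ ((2 * w k `^ q) `^ (1 - 2 / p))).
  by rewrite powR_le// ltW.
rewrite powRM ?(ltW u0)// uE ler_wpM2r ?sqr_ge0//.
apply: (@le_trans _ _ 2); last lra.
have pp : 0 <= 2 / p by rewrite divr_ge0 ?(ltW p_gt0).
by apply: ler1_powR; lra.
Qed.

Hypothesis hw0 : w @ \oo --> (0 : R).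
Hypothesis hdiv : (\sum_(0 <= n <oo) ((w n `^ q)%:E) = +oo)%E.
Variables (T : (nat -> R) -> nat -> R) (delta : R).
Hypothesis Tlin : forall (a : R) x y, inX x -> inX y ->
    T (fun n => a * x n + y n) = (fun n => a * T x n + T y n).
Hypothesis delta0 : 0 < delta.
Hypothesis hdelta : forall n, delta <= `|T (unitv R n) n|.

(* On an interval with [S = sum w^q] comparable to [w k ^ q], the weights [v = w^q / S]
   add up to one, and [vec = e v^(1/p)], [dual = e sg(T_nn) v^(1-1/p)].  The signs [e]
   come from averaging out the off-diagonal part of [T] over the interval. *)
Lemma block_exists N k : exists s, (N <= lo s)%N /\ block_for T delta k s.
Proof.
have t0 : 0 < w k `^ q by exact: powR_gt0.
(* Since [w] tends to zero, far-out terms do not exceed the target [w k ^ q], as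
   [interval_sum_choice] needs. *)
have [N' hN'] : exists N', forall n, (N' <= n)%N -> w n `^ q <= w k `^ q.
  have /cvgrPdist_le /(_ _ (hwpos k)) [N' _ hN'] := hw0.
  exists N' => n /hN' /=; rewrite sub0r normrN gtr0_norm// => h.
  by apply: powR_le => //; exact: ltW.
pose m := maxn N N'.
have [M [mM /andP[S1 S2]]] : exists M, (m < M)%N /\
    w k `^ q <= \sum_(m <= n < M) w n `^ q <= 2 * w k `^ q.
  apply: interval_sum_choice => // [n|n]; first exact: powR_ge0.
  by rewrite geq_max => /andP[_ /hN'].
set S := \sum_(_ <= _ < _) _ in S1 S2.
have S0 : 0 < S by lra.
pose v n := w n `^ q / S.
have v0 n : 0 < v n by rewrite divr_gt0// powR_gt0.
have vsum : \sum_(m <= n < M) v n = 1 by rewrite -mulr_suml mulfV// gt_eqF.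
pose sg n := Num.sg (T (unitv R n) n).
have sg1 n : `|sg n| = 1.
  rewrite /sg normr_sg; case: eqP => //= h.
  by have := hdelta n; rewrite h normr0 leNgt delta0.
(* The signed double sum of this matrix is the pairing of the block with [T] of its vector. The
   factor [sg n] turns the diagonal into [v n * |T (unitv R n) n|], whose sum is at least
   [delta]. *)
have [e [e1 he]] := sign_choice
  (fun n i => sg n * v n `^ (1 - p^-1) * (v i `^ p^-1 * T (unitv R i) n)) m M.
have en n : `|e n| = 1 by rewrite -sqrtr_sqr e1 sqrtr1.
pose beta n := e n * v n `^ p^-1.
pose b n := if (m <= n < M)%N then beta n else 0.
pose g n := e n * sg n * v n `^ (1 - p^-1).
have nb n : `|beta n| = v n `^ p^-1.
  by rewrite normrM en mul1r ger0_norm// powR_ge0.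
have ng n : `|g n| = v n `^ (1 - p^-1).
  by rewrite !normrM en sg1 !mul1r ger0_norm// powR_ge0.
have bE n : (m <= n < M)%N -> b n = beta n by rewrite /b => ->.
have S12 : w k `^ q <= S <= 2 * w k `^ q by apply/andP.
have /andP[D1 D2] := block_size S12.
set D := (S^-1 `^ p^-1) ^+ 2 in D1 D2.
have D0 : 0 < D by rewrite exprn_gt0// powR_gt0// invr_gt0.
exists (Block m M b g); split; first exact: leq_maxl.
split; rewrite /pairing //=.
- by move=> n nm; rewrite /b leqNgt nm.
- by move=> n Mn; rewrite /b [(n < M)%N]ltnNge Mn andbF.
- rewrite big_nat (eq_bigr v) -?big_nat ?vsum// => n nmM.
  by rewrite bE// nb powRVK// ltW.
- rewrite big_nat (eq_bigr (fun n => w n `^ q * D)) -?big_nat -?mulr_suml// => n nmM.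
  rewrite bE// -[LHS]real_normK ?num_real// normrM nb (gtr0_norm (hwpos n)).
  by have [] := block_weight n S0.
- move=> y; apply: le_trans; last first.
    by apply: (@hoelder_unit_sum _ p v y m M) => // [|n]; [move: hp => h; lra | exact: ltW].
  apply: powR_le => //; first exact: ltW.
  by apply: (le_trans (ler_norm_sum _ _ _)); apply: ler_sum => n _; rewrite normrM ng.
(* Cauchy-Schwarz for [g / w] and [y * w]: the squares of the first sum to [1 / (S * D)], at most
   [1 / w k ^ 2] by [D1]. *)
- move=> y; have aE : \sum_(m <= n < M) (g n / w n) ^+ 2 = (S * D)^-1.
    rewrite (eq_bigr (fun n => w n `^ q / (S ^+ 2 * D))) => [|n _].
      by rewrite -mulr_suml -/S; field; rewrite !gt_eqF.
    rewrite -[LHS]real_normK ?num_real// normrM ng (gtr0_norm (_ : 0 < (w n)^-1)) ?invr_gt0//.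
    by have [_] := block_weight n S0.
  have := @cauchy_schwarz_sum _ (fun n => g n / w n) (fun n => y n * w n) m M.
  rewrite aE invr_gt0 mulr_gt0// => /(_ isT).
  rewrite (eq_bigr (fun n => g n * y n)) => [|n _]; last first.
    by field; rewrite gt_eqF.
  set Y := \sum_(_ <= _ < _) (y _ * _) ^+ 2 => h.
  have Y0 : 0 <= Y by apply: sumr_ge0 => n _; exact: sqr_ge0.
  rewrite exprMn mulrC; apply: (le_trans (ler_wpM2l (sqr_ge0 _) h)).
  rewrite mulrA -[leRHS]mul1r ler_wpM2r// ler_pdivrMr ?mul1r// mulr_gt0//.
- have -> : b = fun n => \sum_(m <= i < M) beta i * unitv R i n.
    by apply/funext => n; rewrite sum_unitv.
  rewrite (linear_op_sum hp Tlin); last by move=> i; exact: inX_unitv.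
  apply: le_trans (ler_norm _); apply: le_trans; last first.
    rewrite (_ : \sum_(m <= n < M) _ = \sum_(m <= n < M) \sum_(m <= i < M) e n * e i *
      (sg n * v n `^ (1 - p^-1) * (v i `^ p^-1 * T (unitv R i) n))); first exact: he.
    apply: eq_bigr => n _; rewrite mulr_sumr; apply: eq_bigr => i _.
    rewrite /g /beta; move: (T _ n) (v n `^ _) (v i `^ _) (sg n) (e n) (e i) => *.
    by ring.
  have -> : delta = \sum_(m <= n < M) delta * v n by rewrite -mulr_sumr vsum mulr1.
  apply: ler_sum => n _ /=.
  have -> : sg n * v n `^ (1 - p^-1) * (v n `^ p^-1 * T (unitv R n) n) =
      `|T (unitv R n) n| * (v n `^ (1 - p^-1) * v n `^ p^-1).
    by rewrite normrEsg -/(sg n); move: (T _ n) (v n `^ _) (v n `^ _) (sg n) => *; ring.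
  rewrite -powRD; last by rewrite (gt_eqF (v0 n)) implybT.
  by rewrite subrK powRr1 ?(ltW (v0 n))// ler_wpM2r// ltW.
Qed.

End Blocks.

(** * Neumann series of an operator of norm at most 1/2 *)

Section Neumann.
Variables (R : realType) (p : R) (w : nat -> R) (W : R).
Hypothesis hp : 2 < p.
Hypothesis W1 : 1 <= W.
Hypothesis wW : forall n, `|w n| <= W.
Implicit Types (x y : nat -> R) (c : R).
Local Notation norm_le := (norm_le p w).
Local Notation inX := (inX p w).

(** On the first [L] coordinates some [s N] is uniformly close to [x], and [norm_le_prefix_sum]
    makes this closeness in norm; [L] and the error [e] are arbitrary. *)
Lemma norm_le_lim (s : nat -> nat -> R) x c : (forall N, norm_le (s N) c) ->
  (forall k, s N k @[N --> \oo] --> x k) -> norm_le x c.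
Proof.
move=> sc sx; have [c0 _] := sc 0%N.
apply: (norm_le_closed hp c0) => e e0.
apply: norm_le_prefix => [|L]; first by rewrite addr_ge0// ltW.
have W0 : 0 < W by move: W1 => ?; lra.
(* The [L] coordinate errors, each weighted by [W], total at most [e]; [L.+1] keeps the denominator
   nonzero. *)
pose e' := e / (W * L.+1%:R).
have e'0 : 0 < e' by rewrite divr_gt0// mulr_gt0.
have [N hN] : exists N, forall k, (k < L)%N -> `|x k - s N k| <= e'.
  have [N hN] : exists N, forall M, (N <= M)%N -> forall k, (k < L)%N -> `|x k - s M k| <= e'.
    elim: (L) => [|l [N hN]]; first by exists 0%N.
    have /cvgrPdist_le /(_ _ e'0) [N' _ hN'] := sx l.
    exists (maxn N N') => M; rewrite geq_max => /andP[NM N'M] k.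
    rewrite ltnS leq_eqVlt => /predU1P[->|]; [exact: hN' | exact: hN].
  by exists N => k; exact: hN.
have hd := norm_le_prefix_sum hp (fun k => x k - s N k) L W1 wW.
apply: (norm_leW hp (c := c + \sum_(0 <= k < L) (`|x k - s N k| * W))).
  rewrite lerD2l; apply: (@le_trans _ _ (\sum_(0 <= k < L) e' * W)).
    rewrite big_nat [leRHS]big_nat; apply: ler_sum => k /andP[_ kL].
    by rewrite ler_wpM2r ?(ltW W0)// hN.
  rewrite sumr_const_nat subn0 -mulr_natr /e'.
  have -> : e / (W * L.+1%:R) * W * L%:R = e * (L%:R / L.+1%:R).
    have : L.+1%:R != 0 :> R by rewrite pnatr_eq0.
    by move: (L.+1%:R : R) => l l0; field; rewrite l0 gt_eqF.
  by rewrite -[leRHS]mulr1 ler_wpM2l ?(ltW e0)// ler_pdivrMr// mul1r ler_nat.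
have hs : norm_le (fun n => if (n < L)%N then s N n else 0) c.
  by apply: (norm_le_abs hp _ (sc N)) => n; case: ifP; rewrite ?normr0.
apply: (norm_le_abs hp _ (norm_leD hp hs hd)) => n; case: ifP => _.
  by rewrite addrC subrK.
by rewrite addr0.
Qed.

Variable K : (nat -> R) -> nat -> R.
Hypothesis Klin : forall (a : R) x y, inX x -> inX y ->
    K (fun n => a * x n + y n) = (fun n => a * K x n + K y n).
Hypothesis Khalf : forall x c, norm_le x c -> norm_le (K x) (c / 2).

(** The limit is taken coordinate by coordinate, so no topology on the space is involved. On [inX]
    it is a genuine limit by [neumann_cvg]. *)
Definition neumann y n : R := limn (series (fun i => iter i K y n)).

Lemma iter_norm_le i y c : norm_le y c -> norm_le (iter i K y) (c * 2^-1 ^+ i).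
Proof.
move=> hy; elim: i => [|i IH]; first by rewrite expr0 mulr1.
by rewrite exprSr mulrA; exact: Khalf.
Qed.

Lemma iter_inX i y : inX y -> inX (iter i K y).
Proof. by move=> /(norm_le_Xnorm hp)/(iter_norm_le i)/norm_le_inX. Qed.

Lemma iter_linear i (a : R) x y : inX x -> inX y ->
  iter i K (fun n => a * x n + y n) = (fun n => a * iter i K x n + iter i K y n).
Proof.
move=> hx hy; elim: i => [//|i IH] /=.
by rewrite IH Klin//; exact: iter_inX.
Qed.

Lemma neumann_cvg y n : inX y -> series (fun i => iter i K y n) @ \oo --> neumann y n.
Proof.
move=> /(norm_le_Xnorm hp); set c := Xnorm _ _ _ => hy.
have [c0 _] := hy.
apply: normed_cvg; apply: (@series_le_cvg _ _ (geometric c 2^-1)) => [i|i|i|].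
- exact: normr_ge0.
- by rewrite /geometric /= mulr_ge0// exprn_ge0.
- exact: (norm_le_coord hp n (iter_norm_le i hy)).
- by apply: is_cvg_geometric_series; rewrite ger0_norm//; lra.
Qed.

Lemma neumann_norm_le y c : norm_le y c -> norm_le (neumann y) (2 * c).
Proof.
move=> hy; have Xy := norm_le_inX hy; have [c0 _] := hy.
apply: (@norm_le_lim (fun N n => series (fun i => iter i K y n) N)) => [N|k]; last first.
  exact: neumann_cvg.
(* Keeping the exact geometric partial sum, not just [2 * c], lets the induction close. *)
have : norm_le (fun n => series (fun i => iter i K y n) N) (c * (2 - 2 * 2^-1 ^+ N)).
  elim: N => [|N IH].
    rewrite expr0 mulr1 subrr mulr0; apply: (norm_le_abs hp _ (norm_le0 w hp)) => n.
    by rewrite /series /= big_geq.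
  have -> : c * (2 - 2 * 2^-1 ^+ N.+1) = c * (2 - 2 * 2^-1 ^+ N) + c * 2^-1 ^+ N.
    by rewrite exprS; field.
  apply: (norm_le_abs hp _ (norm_leD hp IH (iter_norm_le N hy))) => n.
  by rewrite /series /= big_nat_recr.
apply: norm_leW => //; rewrite mulrC ler_wpM2r// gerBl mulr_ge0// exprn_ge0//.
Qed.

Lemma neumann_linear (a : R) x y : inX x -> inX y ->
  neumann (fun n => a * x n + y n) = (fun n => a * neumann x n + neumann y n).
Proof.
move=> hx hy; apply/funext => n; apply: cvg_lim => //.
have -> : series (fun i => iter i K (fun n0 => a * x n0 + y n0) n) =
    (fun N => a * series (fun i => iter i K x n) N + series (fun i => iter i K y n) N).
  apply/funext => N; rewrite /series /= mulr_sumr -big_split /=.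
  by apply: eq_bigr => i _; rewrite iter_linear.
apply: cvgD; last exact: neumann_cvg.
by apply: cvgM; [exact: cvg_cst | exact: neumann_cvg].
Qed.

(** The partial sums telescope to [x - iter N K x], and the coordinates of [iter N K x] decay like
    [2^-N]. *)
Lemma neumann_left_inverse x : inX x -> neumann (fun n => x n - K x n) = x.
Proof.
move=> hx; apply/funext => n; apply: cvg_lim => //.
have [c hc] : exists c, norm_le x c by exists (Xnorm p w x); exact: norm_le_Xnorm.
have xE : (fun n => x n - K x n) = (fun n => -1 * K x n + x n).
  by apply/funext => k; rewrite mulN1r addrC.
have -> : series (fun i => iter i K (fun n => x n - K x n) n) =
    (fun N => x n - iter N K x n).
  apply/funext => N; rewrite /series /=; elim: N => [|N IH]; first by rewrite big_geq ?subrr.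
  rewrite big_nat_recr //= IH xE iter_linear//; last exact: (iter_inX 1).
  by rewrite -iterSr /=; ring.
rewrite -[X in _ --> X]subr0; apply: cvgB; first exact: cvg_cst.
apply/cvgr0Pnorm_le => e e0.
have : geometric c 2^-1 @ \oo --> (0 : R).
  by apply: cvg_geometric; rewrite ger0_norm//; lra.
move=> /cvgr0Pnorm_le /(_ _ e0) [N _ hN]; exists N => // M /hN /= h.
apply: le_trans h; apply: le_trans (ler_norm _).
exact: (norm_le_coord hp n (iter_norm_le M hc)).
Qed.

End Neumann.

(** * Sums over supports and common thresholds *)

Lemma sum_support_le (R : realType) (a : nat -> R) m M n :
  (m <= M)%N -> (forall k, 0 <= a k) -> (forall k, (k < m)%N -> a k = 0) ->
  (forall k, (M <= k)%N -> a k = 0) ->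
  \sum_(0 <= k < n) a k <= \sum_(m <= k < M) a k.
Proof.
move=> mM a0 am aM; elim: n => [|n IH]; first by rewrite big_geq//; exact: sumr_ge0.
have sumE i : (i <= m)%N -> \sum_(0 <= k < i) a k = 0.
  move=> im; rewrite big_nat big1// => k /andP[_ ki]; apply: am; exact: leq_trans im.
have [nm|mn] := ltnP n m; first by rewrite sumE//; exact: sumr_ge0.
have [nM|Mn] := ltnP n M; last by rewrite big_nat_recr //= aM// addr0.
rewrite (big_cat_nat (n := m)) //=; last exact: leqW.
rewrite sumE// add0r [leRHS](big_cat_nat (n := n.+1)) //=; last exact: leqW.
by rewrite lerDl sumr_ge0.
Qed.

Lemma sum_subset_le (R : realType) (a : nat -> R) m M n : (M <= n)%N ->
  (forall k, 0 <= a k) -> \sum_(m <= k < M) a k <= \sum_(0 <= k < n) a k.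
Proof.
move=> Mn a0; have [mM|Mm] := leqP m M; last first.
  by rewrite big_geq ?(ltnW Mm)//; exact: sumr_ge0.
rewrite [leRHS](big_cat_nat (n := m)) //=; last exact: leq_trans Mn.
rewrite [X in _ <= _ + X](big_cat_nat (n := M)) //=.
by rewrite addrCA lerDl addr_ge0// sumr_ge0.
Qed.

(** At most one term is nonzero. With [phi] a power this moves the power inside a sum over disjoint
    blocks. *)
Lemma disjoint_sum (R : realType) (phi : R -> R) (z : nat -> R) L : phi 0 = 0 ->
  (forall i j, (i < j)%N -> z i = 0 \/ z j = 0) ->
  phi (\sum_(0 <= k < L) z k) = \sum_(0 <= k < L) phi (z k).
Proof.
move=> phi0 zz; elim: L => [|L IH]; first by rewrite !big_geq.
rewrite !big_nat_recr //= -IH; case: (eqVneq (z L) 0) => [->|zL].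
  by rewrite phi0 !addr0.
rewrite (_ : \sum_(0 <= i < L) z i = 0) ?phi0 ?add0r//.
rewrite big_nat big1// => k /andP[_ /zz[]// h].
by rewrite h eqxx in zL.
Qed.

Lemma uniform_threshold (Q : nat -> nat -> Prop) j :
  (forall i, exists N, forall M, (N <= M)%N -> Q i M) ->
  exists N, forall i, (i < j)%N -> forall M, (N <= M)%N -> Q i M.
Proof.
move=> H; elim: j => [|j [N hN]]; first by exists 0%N.
have [N' hN'] := H j; exists (maxn N N') => i ij M.
rewrite geq_max => /andP[NM N'M]; move: ij; rewrite ltnS leq_eqVlt.
by case/predU1P => [->|ij]; [exact: hN' | exact: hN].
Qed.

(** * The block sequence and the factorization through it *)

Section Factorization.
Variables (R : realType) (p : R) (w : nat -> R) (W : R).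
Hypothesis hp : 2 < p.
Hypothesis W1 : 1 <= W.
Hypothesis wW : forall n, `|w n| <= W.
Variables (T : (nat -> R) -> nat -> R) (delta C : R).
Local Notation norm_le := (norm_le p w).
Local Notation inX := (inX p w).
Local Notation block_for := (block_for p w T delta).
Hypothesis Tlin : forall (a : R) x y, inX x -> inX y ->
    T (fun n => a * x n + y n) = (fun n => a * T x n + T y n).
Hypothesis delta0 : 0 < delta.
Hypothesis C0 : 0 <= C.
Hypothesis TC : forall x c, norm_le x c -> norm_le (T x) (C * c).

Let p_ge0 : 0 <= p. Proof. by move: hp => h; lra. Qed.
Let p0 : p != 0. Proof. by rewrite gt_eqF//; move: hp => h; lra. Qed.
Let pV_ge0 : 0 <= p^-1. Proof. by rewrite invr_ge0. Qed.
Let W0 : 0 < W. Proof. by move: W1 => h; lra. Qed.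

Lemma pairing_linear (s : block R) (a : R) x y :
  pairing s (fun n => a * x n + y n) = a * pairing s x + pairing s y.
Proof.
rewrite /pairing mulr_sumr -big_split /=; apply: eq_bigr => n _; ring.
Qed.

Lemma pairing_sum (s : block R) (r : seq nat) (a : nat -> R) (z : nat -> nat -> R) :
  pairing s (fun n => \sum_(i <- r) a i * z i n) = \sum_(i <- r) a i * pairing s (z i).
Proof.
rewrite /pairing; under eq_bigr do rewrite mulr_sumr.
rewrite exchange_big /=; apply: eq_bigr => i _; rewrite mulr_sumr.
by apply: eq_bigr => n _; ring.
Qed.

Lemma pairing_le k s y c : block_for k s -> norm_le y c -> `|pairing s y| <= c.
Proof.
move=> hs [c0 /(_ (hi s))[h _]].
rewrite -[leLHS](powRK p0 (normr_ge0 _)) -[leRHS](powRK p0 c0).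
apply: powR_le; rewrite ?powR_ge0//.
apply: (le_trans (pairing_lp hs y)); apply: le_trans h.
by apply: sum_subset_le => // i; exact: powR_ge0.
Qed.

Lemma vec_norm_le k s : block_for k s -> norm_le (vec s) (2 * W).
Proof.
move=> hs; have W2 : 1 <= 2 * W by move: W1 => h; lra.
split=> [|n]; first by lra.
have lohi := ltnW (lo_hi hs); split.
  apply: (@le_trans _ _ 1); last first.
    by have := powR_le p_ge0 ler01 W2; rewrite powR1.
  apply: le_trans (vec_lp hs); apply: sum_support_le => [//|i|i|i]; first exact: powR_ge0.
  - by move=> /(vec_lo hs) ->; rewrite normr0 powR0.
  - by move=> /(vec_hi hs) ->; rewrite normr0 powR0.
apply: (@le_trans _ _ (4 * w k ^+ 2)).
  apply: le_trans (vec_l2 hs); apply: sum_support_le => [//|i|i|i]; first exact: sqr_ge0.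
  - by move=> /(vec_lo hs) ->; rewrite mul0r expr0n.
  - by move=> /(vec_hi hs) ->; rewrite mul0r expr0n.
rewrite exprMn (_ : 2 ^+ 2 = 4 :> R); last by ring.
rewrite ler_pM2l// -real_normK ?num_real// ler_sqr ?nnegrE ?(ltW W0)//.
Qed.

(* Each coordinate of [defect] collects errors of total size [3 * eta j] against a
   diagonal entry of size [delta], and must contribute at most [2^-(j+2)] to the norm. *)
Let eta j : R := delta / (3 * W) * 2^-1 ^+ j.+2.

Let eta_gt0 j : 0 < eta j.
Proof. by rewrite mulr_gt0 ?exprn_gt0// divr_gt0// mulr_gt0. Qed.

(** The second clause bounds the pairing with [t] for every vector starting at [lo s], so all later
    blocks can be treated at once. The third shares the budget [eta j] among the [j] blocks before
    [s]; hence the division by [j.+1], nonzero even for [j = 0]. *)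
Definition separated i t j s := [/\ (hi t <= lo s)%N,
  forall x c, norm_le x c -> (forall n, (n < lo s)%N -> x n = 0) ->
    `|pairing t (T x)| <= eta i * c &
  `|pairing s (T (vec t))| <= eta j / j.+1%:R].

(** The map from [x] to [pairing t (T x)] is a bounded functional, hence small on tails; and a
    far-out [s] sees only a tail of [T (vec t)]. *)
Lemma block_separated j i t : block_for i t -> exists N, forall M, (N <= M)%N ->
  forall s, block_for j s -> (M <= lo s)%N -> separated i t j s.
Proof.
move=> ht.
have flin (a : R) x y : inX x -> inX y ->
    pairing t (T (fun n => a * x n + y n)) = a * pairing t (T x) + pairing t (T y).
  by move=> hx hy; rewrite Tlin// pairing_linear.
have fC x c : norm_le x c -> `|pairing t (T x)| <= C * c.
  by move=> /TC; exact: (pairing_le ht).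
have [N1 h1] := functional_tail_small hp C0 flin fC (eta_gt0 i).
have e0 : 0 < eta j / j.+1%:R by rewrite divr_gt0.
have [N2 h2] := norm_le_tail hp (TC (vec_norm_le ht)) e0.
exists (maxn (hi t) (maxn N1 N2)) => M; rewrite !geq_max => /and3P[M0 M1 M2] s hs Ms.
split; first exact: leq_trans Ms.
  move=> x c hx x0; apply: h1 => // n nN; apply: x0.
  by apply: leq_trans nN _; exact: leq_trans Ms.
have -> : pairing s (T (vec t)) =
    pairing s (fun n => if (N2 <= n)%N then T (vec t) n else 0).
  rewrite /pairing big_nat [RHS]big_nat; apply: eq_bigr => n /andP[sn _].
  by rewrite (leq_trans M2 (leq_trans Ms sn)).
exact: (pairing_le hs h2).
Qed.

Lemma block_sequence :
  (forall N k, exists s, (N <= lo s)%N /\ block_for k s) ->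
  exists u : nat -> block R, forall j, block_for j (u j) /\
    forall i, (i < j)%N -> separated i (u i) j (u j).
Proof.
move=> ex; have [s0 _] := ex 0%N 0%N.
(* The premise that the stored entries are blocks makes [P] satisfiable after any list, as
   [history_choice] demands; [good] discharges it. [s0] is the default of [nth]. *)
pose P l s := block_for (size l) s /\ forall i, (i < size l)%N ->
  block_for i (nth s0 l i) -> separated i (nth s0 l i) (size l) s.
have [l|u hu] := @history_choice _ P.
  have [i|N hN] := @uniform_threshold (fun i M => block_for i (nth s0 l i) ->
    forall s, block_for (size l) s -> (M <= lo s)%N ->
      separated i (nth s0 l i) (size l) s) (size l).
    case: (pselect (block_for i (nth s0 l i))) => [h|nh]; last by exists 0%N.
    by have [N hN] := block_separated (size l) h; exists N => M NM _; exact: hN.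
  have [s [Ns hs]] := ex N (size l); exists s; split=> // i il hi.
  exact: hN hs Ns.
have good j : block_for j (u j) by have [] := hu j; rewrite size_mkseq.
exists u => j; split=> // i ij; have [_] := hu j.
by rewrite size_mkseq => /(_ i ij); rewrite nth_mkseq//; apply.
Qed.

Variable u : nat -> block R.
Hypothesis hu : forall j, block_for j (u j).
Hypothesis usep : forall j i, (i < j)%N -> separated i (u i) j (u j).

Let hi_lo i j : (i < j)%N -> (hi (u i) <= lo (u j))%N.
Proof. by move=> /usep[]. Qed.

Let lo_mono i j : (i <= j)%N -> (lo (u i) <= lo (u j))%N.
Proof.
rewrite leq_eqVlt => /predU1P[->//|/hi_lo]; apply: leq_trans.
exact: ltnW (lo_hi (hu i)).
Qed.

Let lo_ge j : (j <= lo (u j))%N.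
Proof.
elim: j => // j IH; apply: leq_trans (hi_lo (ltnSn j)).
by apply: leq_ltn_trans IH _; exact: lo_hi (hu j).
Qed.

Let vec0 k n : (n < k)%N -> vec (u k) n = 0.
Proof. by move=> nk; apply: (vec_lo (hu k)); apply: leq_trans (lo_ge k). Qed.

(* The sum may stop at [n] because block [k] starts at or after [k]. *)
Definition synth (a : nat -> R) n := \sum_(0 <= k < n.+1) a k * vec (u k) n.

Lemma synthE a n L : (n < L)%N -> synth a n = \sum_(0 <= k < L) a k * vec (u k) n.
Proof.
move=> nL; rewrite [RHS](big_cat_nat (n := n.+1)) //=.
have -> : \sum_(n.+1 <= k < L) a k * vec (u k) n = 0; last by rewrite addr0.
by rewrite big_nat big1// => k /andP[nk _]; rewrite vec0 ?mulr0.
Qed.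

Lemma synth_linear (c : R) x y :
  synth (fun n => c * x n + y n) = fun n => c * synth x n + synth y n.
Proof.
apply/funext => n; rewrite /synth mulr_sumr -big_split /=.
by apply: eq_bigr => k _; ring.
Qed.

Let vec_disjoint i j n : (i < j)%N -> vec (u i) n = 0 \/ vec (u j) n = 0.
Proof.
move=> ij; have [h|h] := leqP (hi (u i)) n; first by left; exact: vec_hi (hu i) _ h.
by right; apply: (vec_lo (hu j)); apply: leq_trans h (hi_lo ij).
Qed.

(** Disjoint supports split both sums over blocks; block [k] contributes at most [|a k| ^ p] and
    [4 * (a k * w k) ^ 2], whence the constant 2. *)
Lemma synth_norm_le a c : norm_le a c -> norm_le (synth a) (2 * c).
Proof.
move=> [c0 hn]; split=> [|n]; first by rewrite mulr_ge0.
have disj m i j : (i < j)%N -> a i * vec (u i) m = 0 \/ a j * vec (u j) m = 0.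
  by move=> /(vec_disjoint m)[] ->; rewrite mulr0; [left|right].
have lohi k := ltnW (lo_hi (hu k)).
have [h1 h2] := hn n; split.
  have -> : \sum_(0 <= m < n) `|synth a m| `^ p =
      \sum_(0 <= m < n) \sum_(0 <= k < n) `|a k| `^ p * `|vec (u k) m| `^ p.
    rewrite big_nat [RHS]big_nat; apply: eq_bigr => m /andP[_ mn].
    rewrite (synthE _ mn) (disjoint_sum (phi := fun t => `|t| `^ p)).
    - by apply: eq_bigr => k _; rewrite normrM powRM.
    - by rewrite normr0 powR0.
    - exact: disj.
  rewrite exchange_big /=; apply: (@le_trans _ _ (c `^ p)); last first.
    by apply: powR_le => //; lra.
  apply: le_trans h1; apply: ler_sum => k _; rewrite -mulr_sumr -[leRHS]mulr1.
  rewrite ler_wpM2l ?powR_ge0//; apply: le_trans (vec_lp (hu k)).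
  apply: sum_support_le => [//|i|i|i]; first exact: powR_ge0.
  - by move=> /(vec_lo (hu k)) ->; rewrite normr0 powR0.
  - by move=> /(vec_hi (hu k)) ->; rewrite normr0 powR0.
have -> : \sum_(0 <= m < n) (synth a m * w m) ^+ 2 =
    \sum_(0 <= m < n) \sum_(0 <= k < n) a k ^+ 2 * (vec (u k) m * w m) ^+ 2.
  rewrite big_nat [RHS]big_nat; apply: eq_bigr => m /andP[_ mn].
  rewrite (synthE _ mn) (disjoint_sum (phi := fun t => (t * w m) ^+ 2)).
  - by apply: eq_bigr => k _; rewrite -mulrA exprMn.
  - by rewrite mul0r expr0n.
  - exact: disj.
rewrite exchange_big /= exprMn (_ : 2 ^+ 2 = 4 :> R); last by ring.
apply: (@le_trans _ _ (4 * \sum_(0 <= k < n) (a k * w k) ^+ 2)); last by rewrite ler_pM2l.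
rewrite mulr_sumr; apply: ler_sum => k _; rewrite -mulr_sumr exprMn mulrCA.
rewrite ler_wpM2l ?sqr_ge0//; apply: le_trans (vec_l2 (hu k)).
apply: sum_support_le => [//|i|i|i]; first exact: sqr_ge0.
- by move=> /(vec_lo (hu k)) ->; rewrite mul0r expr0n.
- by move=> /(vec_hi (hu k)) ->; rewrite mul0r expr0n.
Qed.

Lemma sum_blocks_le (a : nat -> R) L : (forall n, 0 <= a n) ->
  \sum_(0 <= j < L) \sum_(lo (u j) <= n < hi (u j)) a n <= \sum_(0 <= n < lo (u L)) a n.
Proof.
move=> a0; elim: L => [|L IH]; first by rewrite big_geq//; exact: sumr_ge0.
rewrite big_nat_recr //=; apply: le_trans (lerD IH (lexx _)) _.
rewrite -big_cat_nat //=; last exact: ltnW (lo_hi (hu L)).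
by apply: sum_subset_le => //; exact: hi_lo.
Qed.

(** The bounds [pairing_lp] and [pairing_l2] add up over disjoint intervals without loss. *)
Lemma pairings_norm_le y c : norm_le y c -> norm_le (fun j => pairing (u j) y) c.
Proof.
move=> [c0 hn]; split=> // n; have [h1 h2] := hn (lo (u n)); split.
  apply: le_trans h1; apply: le_trans (sum_blocks_le _ _) => [|i]; last exact: powR_ge0.
  by apply: ler_sum => j _; exact: pairing_lp (hu j) y.
apply: le_trans h2; apply: le_trans (sum_blocks_le _ _) => [|i]; last exact: sqr_ge0.
by apply: ler_sum => j _; exact: pairing_l2 (hu j) y.
Qed.

Let lam j := pairing (u j) (T (vec (u j))).

Let lam_ge j : delta <= `|lam j|. Proof. exact: pairing_diag (hu j). Qed.

Let lam_neq0 j : lam j != 0.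
Proof. by rewrite -normr_gt0; apply: lt_le_trans (lam_ge j). Qed.

(** Dividing by [lam j] gives the composite of [synth], [T] and [analysis] a unit diagonal. *)
Definition analysis y j := pairing (u j) y / lam j.

Lemma analysis_norm_le y c : norm_le y c -> norm_le (analysis y) (delta^-1 * c).
Proof.
move=> hy; have := norm_leZ delta^-1 (pairings_norm_le hy).
rewrite gtr0_norm ?invr_gt0//; apply: (norm_le_abs hp) => j.
rewrite /analysis !normrM normfV mulrC ler_wpM2r//.
rewrite [leRHS]gtr0_norm ?invr_gt0// lef_pV2 ?posrE//.
by apply: lt_le_trans (lam_ge j).
Qed.

(** As the normalised diagonal is one, only the off-diagonal part of the compression of [T] survives
    here. *)
Definition defect (a : nat -> R) j := a j - analysis (T (synth a)) j.

Let synth_inX a : inX a -> inX (synth a).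
Proof. by move=> /(norm_le_Xnorm hp)/synth_norm_le/norm_le_inX. Qed.

Lemma analysis_linear (c : R) x y :
  analysis (fun n => c * x n + y n) = fun n => c * analysis x n + analysis y n.
Proof.
by apply/funext => j; rewrite /analysis pairing_linear mulrDl mulrA.
Qed.

Lemma defect_linear (c : R) x y : inX x -> inX y ->
  defect (fun n => c * x n + y n) = fun n => c * defect x n + defect y n.
Proof.
move=> hx hy; apply/funext => j.
by rewrite /defect synth_linear Tlin ?analysis_linear; [ring| exact: synth_inX..].
Qed.

(** Linearity of [T] distributes over finite sums only, so the blocks after [j] stay together as one
    vector. The factor [1] matches the shape of [Tlin]. *)
Lemma synth_split a j : synth a = fun n => 1 * \sum_(0 <= i < j.+1) a i * vec (u i) n +
  synth (fun k => if (j < k)%N then a k else 0) n.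
Proof.
apply/funext => n; rewrite mul1r; pose L := maxn n.+1 j.+1.
rewrite !(@synthE _ n L) ?leq_maxl//.
rewrite (big_cat_nat (n := j.+1)) ?leq_maxr//=; congr (_ + _).
rewrite [RHS](big_cat_nat (n := j.+1)) ?leq_maxr//=.
have -> : \sum_(0 <= k < j.+1) (if (j < k)%N then a k else 0) * vec (u k) n = 0.
  rewrite big_nat big1// => k /andP[_]; rewrite ltnS leqNgt => /negbTE ->.
  by rewrite mul0r.
rewrite add0r big_nat [RHS]big_nat; apply: eq_bigr => k /andP[jk _].
by rewrite jk.
Qed.

Lemma defect_coord_le a c j : norm_le a c -> `|defect a j| * W <= c * 2^-1 ^+ j.+2.
Proof.
move=> ha; have [c0 _] := ha.
pose a' k := if (j < k)%N then a k else 0.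
have ha' : norm_le a' c.
  by apply: (norm_le_abs hp _ ha) => k; rewrite /a'; case: ifP; rewrite ?normr0.
have E : pairing (u j) (T (synth a)) =
    \sum_(0 <= i < j) a i * pairing (u j) (T (vec (u i))) + a j * lam j +
    pairing (u j) (T (synth a')).
  have vX i : inX (vec (u i)) by exact: norm_le_inX (vec_norm_le (hu i)).
  rewrite (synth_split a j) Tlin; [| exact: inX_sum | exact: synth_inX (norm_le_inX ha')].
  rewrite pairing_linear mul1r (linear_op_sum hp Tlin)// pairing_sum.
  by rewrite big_nat_recr.
have b1 : `|\sum_(0 <= i < j) a i * pairing (u j) (T (vec (u i)))| <= eta j * c.
  apply: (le_trans (ler_norm_sum _ _ _)).
  apply: (@le_trans _ _ (\sum_(0 <= i < j) c * (eta j / j.+1%:R))).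
    rewrite big_nat [leRHS]big_nat; apply: ler_sum => i /andP[_ ij].
    have [_ _ h] := usep ij; rewrite normrM ler_pM//.
    exact: (norm_le_coord hp i ha).
  rewrite sumr_const_nat subn0 -[leLHS]mulr_natr.
  have -> : c * (eta j / j.+1%:R) * j%:R = eta j * c * (j%:R / j.+1%:R).
    have : j.+1%:R != 0 :> R by rewrite pnatr_eq0.
    by move: (j.+1%:R : R) => l l0; field.
  have ec0 : 0 <= eta j * c by apply: mulr_ge0 => //; exact: ltW.
  rewrite -[leRHS]mulr1; apply: ler_wpM2l => //.
  by rewrite ler_pdivrMr// mul1r ler_nat.
(* The later blocks form one vector of norm at most [2 * c] starting at [lo (u j.+1)], so separation
   from the next block alone suffices. *)
have b2 : `|pairing (u j) (T (synth a'))| <= eta j * (2 * c).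
  have [_ h _] := usep (ltnSn j); apply: h; first exact: synth_norm_le.
  move=> n nlo; rewrite /synth big1// => k _; rewrite /a'.
  case: ifP => [jk|]; last by rewrite mul0r.
  by rewrite (vec_lo (hu k)) ?mulr0//; apply: leq_trans nlo (lo_mono jk).
have -> : defect a j = - ((\sum_(0 <= i < j) a i * pairing (u j) (T (vec (u i))) +
    pairing (u j) (T (synth a'))) / lam j).
  rewrite /defect /analysis E; set s1 := \sum_(_ <= _ < _) _; set s2 := pairing _ (T (synth a')).
  by field; exact: lam_neq0.
rewrite normrN normrM normfV -ler_pdivlMr//.
rewrite ler_pdivrMr; last by apply: lt_le_trans (lam_ge j).
apply: (le_trans (ler_normD _ _)).
apply: (@le_trans _ _ (3 * eta j * c)); first by lra.
have -> : 3 * eta j * c = c * 2^-1 ^+ j.+2 / W * delta.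
  by rewrite /eta; field; rewrite gt_eqF.
by rewrite ler_wpM2l// divr_ge0 ?(ltW W0)// mulr_ge0// exprn_ge0.
Qed.

(** Coordinates are summed with weight [W], a bound for the norms of unit vectors; the numbers
    [2^-(j+2)] add up to 1/2. *)
Lemma defect_half a c : norm_le a c -> norm_le (defect a) (c / 2).
Proof.
move=> ha; have [c0 _] := ha.
apply: norm_le_prefix => [|N]; first by rewrite divr_ge0.
apply: (norm_leW hp _ (norm_le_prefix_sum hp (defect a) N W1 wW)).
apply: (@le_trans _ _ (\sum_(0 <= j < N) c * 2^-1 ^+ j.+2)).
  by apply: ler_sum => j _; exact: defect_coord_le.
suff -> : \sum_(0 <= j < N) c * 2^-1 ^+ j.+2 = c / 2 - c / 2 * 2^-1 ^+ N.
  by rewrite gerBl mulr_ge0 ?exprn_ge0// divr_ge0.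
elim: N => [|N IH]; first by rewrite big_geq// expr0 mulr1 subrr.
by rewrite big_nat_recr //= IH !exprS; field.
Qed.

(** Applying [synth], then [T], then [analysis] gives the identity minus [defect]; as [defect] has
    norm at most 1/2, its Neumann series undoes this from the left. *)
Lemma factorization : exists A B : (nat -> R) -> (nat -> R),
  [/\ bounded_op p w A, bounded_op p w B & forall x, inX x -> A (T (B x)) = x].
Proof.
exists (fun y => neumann defect (analysis y)), synth; split.
- apply: (norm_le_bounded_op hp (C := 2 * delta^-1)) => [x c hx|a x y hx hy].
    rewrite -mulrA; apply: (neumann_norm_le hp W1 wW defect_half).
    exact: analysis_norm_le.
  have aX z : inX z -> inX (analysis z).
    by move=> /(norm_le_Xnorm hp)/analysis_norm_le/norm_le_inX.
  by rewrite analysis_linear (neumann_linear hp defect_linear defect_half)//; exact: aX.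
- apply: (norm_le_bounded_op hp (C := 2)); first exact: synth_norm_le.
  by move=> a x y _ _; exact: synth_linear.
move=> x hx; rewrite -[RHS](neumann_left_inverse hp defect_linear defect_half hx).
by congr neumann; apply/funext => j; rewrite /defect subKr.
Qed.

End Factorization.

Theorem mainTheorem3 (R : realType) (p : R) (w : nat -> R)
  (hp : 2 < p)
  (hwpos : forall n, 0 < w n)
  (hw0 : w @ \oo --> (0 : R))
  (hdiv : (\sum_(0 <= n <oo) ((w n `^ (2 * p / (p - 2)))%:E) = +oo)%E) :
  forall T : (nat -> R) -> (nat -> R),
    bounded_op p w T ->
    (exists2 delta : R, 0 < delta &
       forall n, delta <= `|T (unitv R n) n|) ->
    exists A B : (nat -> R) -> (nat -> R),
      [/\ bounded_op p w A, bounded_op p w B &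
          forall x, inX p w x -> A (T (B x)) = x].
Proof.
move=> T Top [delta delta0 hdelta]; have [_ Tlin _] := Top.
have [C C0 TC] := bounded_op_norm_le hp Top.
(* A convergent sequence is bounded; [W >= 1] makes [W] bound the [l_p] norm of the unit vectors as
   well. *)
have [W W1 wW] : exists2 W : R, 1 <= W & forall n, `|w n| <= W.
  have /cvg_seq_bounded/bounded_fun_has_ubound[M hM] : cvgn w by apply/cvg_ex; exists 0.
  exists (Num.max 1 M) => [|n]; first by rewrite le_max lexx.
  by rewrite gtr0_norm// le_max; apply/orP; right; apply: hM; exists n.
have [u hu] := block_sequence hp W1 wW Tlin delta0 C0 TC
  (block_exists hp hwpos hw0 hdiv Tlin delta0 hdelta).
exact: (factorization hp W1 wW Tlin delta0 (fun j => (hu j).1) (fun j => (hu j).2)).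
Qed.
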